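(* Let $k\geq 2$ be an integer. For any graph $G$ with minimum degree $\delta(G)\geq k-1$, \[ \gamma_{\times k}(G)+k\leq \gamma_{\times kR}(G)\leq 2\gamma_{\times k}(G), \] and the lower bound is sharp (that is, there exists a graph $G$ with $\delta(G)\geq k-1$ and $\gamma_{\times kR}(G)=\gamma_{\times k}(G)+k$).
   Context: All graphs are finite, undirected and simple. For an integer $k\geq 1$ and a graph $G=(V,E)$ with minimum degree at least $k-1$, a Roman $k$-tuple dominating function (R$k$DF) on $G$ is a function $f\colon V\to\{0,1,2\}$ such that every vertex $v$ with $f(v)=0$ has at least $k$ neighbors $w$ with $f(w)=2$, and every vertex $v$ with $f(v)\neq 0$ has at least $k-1$ neighbors $w$ with $f(w)=2$. The weight of $f$ is $f(V)=\sum_{v\in V}f(v)$, and $\gamma_{\times kR}(G)$ is the minimum weight of an R$k$DF on $G$. A $k$-tuple dominating set of $G$ is a subset $S\subseteq V$ with $|N_G[v]\cap S|\geq k$ for every $v\in V$, where $N_G[v]$ is the closed neighborhood of $v$; the $k$-tuple domination number $\gamma_{\times k}(G)$ is the minimum cardinality of such a set. *)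

(* Defs.v *)
From mathcomp Require Import all_boot.

Set Implicit Arguments.
Unset Strict Implicit.
Unset Printing Implicit Defensive.

Record sgraph := SGraph {
  vertex :> finType;
  adj : rel vertex;
  adj_sym : symmetric adj;
  adj_irr : irreflexive adj }.

Section Domination.

Variable G : sgraph.

Definition nbh (v : G) : {set G} := [set w | adj v w].

Definition cnbh (v : G) : {set G} := v |: nbh v.

Definition deg (v : G) : nat := #|nbh v|.

(* Every degree is less than the order #|G|, so for a nonempty graph the unit
   #|G| of the iterated minimum is never the result.  The empty graph gets
   minimum degree 0. *)
Definition min_deg : nat := \big[minn/#|G|]_(v : G) deg v.

Definition tuple_dominating (k : nat) (S : {set G}) : bool :=
  [forall v : G, k <= #|cnbh v :&: S|].

(* The default setT is k-tuple dominating when k.-1 <= min_deg and 0 < k, so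
   that this is then a genuine minimum. *)
Definition tuple_dom_num (k : nat) : nat :=
  #|[arg min_(S < [set: G] | tuple_dominating k S) #|S|]|.

Definition roman_dominating (k : nat) (f : {ffun G -> 'I_3}) : bool :=
  [forall v : G,
     if f v == 0 :> nat then k <= #|[set w in nbh v | f w == 2 :> nat]|
     else k.-1 <= #|[set w in nbh v | f w == 2 :> nat]|].

Definition weight (f : {ffun G -> 'I_3}) : nat := \sum_(v : G) f v.

(* The default is the constant function 2, which is Roman k-tuple dominating
   when k.-1 <= min_deg. *)
Definition roman_tuple_dom_num (k : nat) : nat :=
  weight [arg min_(f < [ffun=> ord_max] | roman_dominating k f) weight f].

End Domination.

(* Main.v *)
(** For a Roman dominating f, the support of f is k-tuple dominating and its
    weight is the size of the support plus the number of vertices of value 2.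
    Any vertex has a neighbour of value 2 (as k >= 2), which itself has k - 1
    such neighbours, so at least k vertices have value 2.  Conversely, twice the
    indicator function of a k-tuple dominating set is Roman dominating.  For the
    complete graph on k vertices the two bounds coincide. *)

Require Import Defs.
From mathcomp Require Import all_boot.

Set Implicit Arguments.
Unset Strict Implicit.
Unset Printing Implicit Defensive.

Lemma min_deg_le (G : sgraph) (v : G) : min_deg G <= deg v.
Proof.
rewrite /min_deg; have: v \in index_enum G by rewrite mem_index_enum.
elim: (index_enum G) => // u s IHs; rewrite inE big_cons => /predU1P[->|/IHs].
  exact: geq_minl.
exact/leq_trans/geq_minr.
Qed.

(** The split is disjoint because irreflexivity of [adj] keeps [v] out of [nbh v]. *)
Lemma card_cnbhI (G : sgraph) (v : G) (S : {set G}) :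
  #|cnbh v :&: S| = (v \in S) + #|nbh v :&: S|.
Proof.
rewrite (cardsD1 v) !inE eqxx; congr (_ + #|pred_of_set _|).
apply/setP=> w; rewrite !inE.
by case: eqVneq => // ->; rewrite adj_irr.
Qed.

(** Pointwise, a value among 0, 1, 2 is the sum of the indicators of being nonzero and of being
    2. *)
Lemma weightE (G : sgraph) (f : {ffun G -> 'I_3}) :
  weight f = #|[set v | f v != 0 :> nat]| + #|[set v | f v == 2 :> nat]|.
Proof.
rewrite -!sum1dep_card (big_mkcond (fun v => f v != 0 :> nat)).
rewrite (big_mkcond (fun v => f v == 2 :> nat)) -big_split /=.
by apply: eq_bigr => v _; case: (f v) => -[|[|[|m]]].
Qed.

Section Bounds.

Variables (G : sgraph) (k : nat).

Lemma tuple_dominating_setT :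
  k.-1 <= min_deg G -> tuple_dominating k [set: G].
Proof.
move=> hG; apply/forallP=> v; rewrite card_cnbhI inE setIT.
by rewrite -leq_subLR subn1; apply: leq_trans hG (min_deg_le v).
Qed.

Lemma tuple_dom_numP : k.-1 <= min_deg G ->
  exists2 S : {set G}, tuple_dominating k S & tuple_dom_num G k = #|S|.
Proof.
move=> hG; rewrite /tuple_dom_num.
by case: arg_minnP => [|S hS _]; [exact: tuple_dominating_setT | exists S].
Qed.

Lemma tuple_dom_num_le (S : {set G}) : k.-1 <= min_deg G ->
  tuple_dominating k S -> tuple_dom_num G k <= #|S|.
Proof.
move=> hG hS; rewrite /tuple_dom_num.
by case: arg_minnP => [|T _ ->]; first exact: tuple_dominating_setT.
Qed.

Lemma roman_dominating_cst2 :
  k.-1 <= min_deg G -> roman_dominating k [ffun _ : G => ord_max].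
Proof.
move=> hG; apply/forallP=> v; rewrite ffunE /=.
have -> : [set w in nbh v | [ffun=> ord_max : 'I_3] w == 2 :> nat] = nbh v.
  by apply/setP=> w; rewrite !inE ffunE andbT.
exact: leq_trans hG (min_deg_le v).
Qed.

Lemma roman_tuple_dom_numP : k.-1 <= min_deg G ->
  exists2 f : {ffun G -> 'I_3},
    roman_dominating k f & roman_tuple_dom_num G k = weight f.
Proof.
move=> hG; rewrite /roman_tuple_dom_num.
by case: arg_minnP => [|f hf _]; [exact: roman_dominating_cst2 | exists f].
Qed.

Lemma roman_tuple_dom_num_le (f : {ffun G -> 'I_3}) : k.-1 <= min_deg G ->
  roman_dominating k f -> roman_tuple_dom_num G k <= weight f.
Proof.
move=> hG hf; rewrite /roman_tuple_dom_num.
by case: arg_minnP => [|g _ ->]; first exact: roman_dominating_cst2.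
Qed.

(** Merges the two cases of the definition: the indicator of [f v != 0] absorbs the drop from [k] to
    [k.-1], which gives the shape of [card_cnbhI]. *)
Lemma roman_dominating_nbh (f : {ffun G -> 'I_3}) (v : G) :
  roman_dominating k f ->
  k <= (f v != 0 :> nat) + #|nbh v :&: [set w | f w == 2 :> nat]|.
Proof.
move=> /forallP/(_ v); rewrite -setIdE; case: eqP => // _.
by rewrite -leq_subLR subn1.
Qed.

Lemma roman_dominating_support (f : {ffun G -> 'I_3}) :
  roman_dominating k f -> tuple_dominating k [set v | f v != 0 :> nat].
Proof.
move=> hf; apply/forallP=> v; rewrite card_cnbhI inE.
apply: leq_trans (roman_dominating_nbh v hf) _; rewrite leq_add2l.
by apply/subset_leq_card/setIS/subsetP=> w; rewrite !inE => /eqP->.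
Qed.

Lemma roman_dominating_card2 (f : {ffun G -> 'I_3}) (v : G) : 1 < k ->
  roman_dominating k f -> k <= #|[set w | f w == 2 :> nat]|.
Proof.
move=> hk hf; set V2 := [set w | _].
have /card_gt0P[u] : 0 < #|nbh v :&: V2|.
  (* The indicator contributes at most 1 while [k] is at least 2, so some neighbour is counted. *)
  have := leq_trans hk (roman_dominating_nbh v hf).
  by case: (_ != _) => //; apply: leq_trans.
rewrite inE => /andP[_ uV2].
(* Counting inside the closed neighbourhood of [u] suffices: [u] itself adds one to its [k.-1]
   neighbours in [V2]. *)
apply: leq_trans (subset_leq_card (subsetIr (cnbh u) V2)).
have := roman_dominating_nbh u hf; rewrite card_cnbhI uV2.
by move: uV2; rewrite inE => /eqP->.
Qed.

Lemma roman_tuple_dom_num_ge : 1 < k -> k.-1 <= min_deg G ->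
  tuple_dom_num G k + k <= roman_tuple_dom_num G k.
Proof.
move=> hk hG; have [f hf ->] := roman_tuple_dom_numP hG.
have [v _|G0] := pickP G; last first.
  (* The empty graph is excluded: its minimum degree is 0, below [k.-1]. *)
  by move: hG; rewrite /min_deg big_pred0 // eq_card0 // leqn0 -subn1 subn_eq0 leqNgt hk.
rewrite weightE leq_add ?(roman_dominating_card2 v) //.
exact/tuple_dom_num_le/roman_dominating_support.
Qed.

Lemma roman_tuple_dom_num_le_double : k.-1 <= min_deg G ->
  roman_tuple_dom_num G k <= 2 * tuple_dom_num G k.
Proof.
move=> hG; have [S /forallP hS ->] := tuple_dom_numP hG.
pose f := [ffun v : G => if v \in S then ord_max else ord0 : 'I_3].
have f2 v : (f v == 2 :> nat) = (v \in S) by rewrite ffunE; case: ifP.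
have f0 v : (f v == 0 :> nat) = (v \notin S) by rewrite ffunE; case: ifP.
have -> : 2 * #|S| = weight f.
  have S0 : [set v | f v != 0 :> nat] = S.
    by apply/setP=> v; rewrite inE f0 negbK.
  have S2 : [set v | f v == 2 :> nat] = S by apply/setP=> v; rewrite inE f2.
  by rewrite weightE S0 S2 addnn mul2n.
apply: roman_tuple_dom_num_le => //; apply/forallP=> v.
have -> : [set w in nbh v | f w == 2 :> nat] = nbh v :&: S.
  by apply/setP=> w; rewrite !inE f2.
(* If [v] lies in [S], it accounts for one of the [k] members of [S] in its closed neighbourhood,
   leaving [k.-1] neighbours. *)
have := hS v; rewrite card_cnbhI f0; case: (v \in S) => //=.
by rewrite -leq_subLR subn1.
Qed.

End Bounds.

Lemma neq_sym (T : eqType) : symmetric (fun u v : T => u != v).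
Proof. by move=> u v; rewrite eq_sym. Qed.

Lemma neq_irr (T : eqType) : irreflexive (fun u v : T => u != v).
Proof. by move=> u; rewrite eqxx. Qed.

Definition complete_graph (n : nat) : sgraph :=
  SGraph (@neq_sym 'I_n) (@neq_irr 'I_n).

(** Each vertex is adjacent to all others; the induction also meets the unit of the minimum, here
    the order [n]. *)
Lemma min_deg_complete (n : nat) : n.-1 <= min_deg (complete_graph n).
Proof.
rewrite /min_deg; elim/big_ind: _ => [|x y|v _].
- by rewrite card_ord leq_pred.
- by rewrite leq_min => -> ->.
rewrite /deg; have -> : nbh v = [set~ v].
  by apply/setP=> w; rewrite !inE eq_sym.
by rewrite cardsC1 card_ord.
Qed.

Theorem theorem2 (k : nat) (hk : 2 <= k) :
  (forall G : sgraph, k.-1 <= min_deg G ->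
     tuple_dom_num G k + k <= roman_tuple_dom_num G k <= 2 * tuple_dom_num G k)
  /\
  (exists G : sgraph, k.-1 <= min_deg G /\
     roman_tuple_dom_num G k = tuple_dom_num G k + k).
Proof.
have bounds (G : sgraph) : k.-1 <= min_deg G ->
    tuple_dom_num G k + k <= roman_tuple_dom_num G k <= 2 * tuple_dom_num G k.
  by move=> hG; rewrite roman_tuple_dom_num_ge ?roman_tuple_dom_num_le_double.
split=> //; exists (complete_graph k); have hK := min_deg_complete k.
split=> //; have /andP[lb ub] := bounds _ hK.
(* The upper bound meets the lower one once the domination number is at most [k], and here the whole
   vertex set is a dominating set of size [k]. *)
apply/eqP; rewrite eqn_leq lb andbT (leq_trans ub) // mul2n -addnn leq_add2l.
have := tuple_dom_num_le hK (tuple_dominating_setT hK).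
by rewrite cardsT card_ord.
Qed.
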